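(* Let $n\ge 2$ and let $Z \subset \mathbb{P}^n$ be a set of at most $n+3$ points spanning $\mathbb{P}^n$. Suppose that $Z$ is in linearly general position if $|Z| = n+3$. Then \[ \widehat\alpha(I_Z) \ge \frac{\alpha(I_Z)+n-1}{n}. \]
   Context: $R = K[x_0,\ldots,x_n]$ over an arbitrary field $K$, $\mathbb{P}^n$ is projective space over $K$. $I_Z\subset R$ is the homogeneous ideal of the finite point set $Z$, and $I_Z^{(k)} = \bigcap_{P\in Z} I_P^k$ its $k$-th symbolic power. For a homogeneous ideal $I\neq0$, $\alpha(I)=\min\{j : [I]_j\neq 0\}$. The Waldschmidt constant is $\widehat\alpha(I_Z) = \lim_{k\to\infty} \frac{\alpha(I_Z^{(k)})}{k}$ (the limit always exists). A finite set of points in $\mathbb{P}^n$ is in linearly general position if every subset of $r+1 \le n+1$ of its points spans an $r$-dimensional linear subspace. *)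

(* Defs.v *)
From HB Require Import structures.
From mathcomp Require Import all_boot all_order all_algebra finmap.
From mathcomp Require Import boolp classical_sets reals topology normedtype
  sequences.
(* Some notation levels of mpoly clash with those of mathcomp-analysis. *)
From mathcomp Require Import -(notations) mpoly.

Set Implicit Arguments.
Unset Strict Implicit.
Unset Printing Implicit Defensive.

Import Order.TTheory GRing.Theory Num.Theory.
Import numFieldNormedType.Exports.

Local Open Scope classical_set_scope.
Local Open Scope ring_scope.

Section Ideals.
Variable A : comNzRingType.

Definition ideal_gen (S : set A) : set A :=
  [set f | exists2 s : seq (A * A),
     (forall x, x \in s -> S x.2) & f = \sum_(x <- s) x.1 * x.2].

Definition ideal_mul (I J : set A) : set A :=
  ideal_gen [set h | exists f g, [/\ I f, J g & h = f * g]].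

Definition ideal_exp (I : set A) (k : nat) : set A :=
  iter k (ideal_mul I) setT.

End Ideals.

Definition homogeneous (K : fieldType) (N d : nat) (f : mpoly N K) : Prop :=
  f \is ishomog1 d mdeg.

(* Junk value 0 on ideals without nonzero homogeneous elements. *)
Definition alpha (K : fieldType) (N : nat) (I : set (mpoly N K)) : nat :=
  let P j := `[< exists f, [/\ I f, homogeneous j f & f != 0] >] in
  if pselect (exists j, P j) is left exP then ex_minn exP else 0%N.

Section ProjectiveSpace.
Variables (K : fieldType) (n : nat).

(* Points of P^n are the lines through the origin of K^(n+1). *)
Definition proj_point := {L : {vspace 'rV[K]_n.+1} | \dim L == 1%N}.

HB.instance Definition _ := Choice.on proj_point.

Definition vanishes_at (f : mpoly n.+1 K) (P : proj_point) : Prop :=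
  forall v : 'rV[K]_n.+1, v \in val P -> v != 0 -> meval (v ord0) f = 0.

Definition vanishing_ideal (Z : {fset proj_point}) : set (mpoly n.+1 K) :=
  ideal_gen [set f | (exists d, homogeneous d f) /\
                     forall P, P \in Z -> vanishes_at f P].

Definition symbolic_power (Z : {fset proj_point}) (k : nat) :
    set (mpoly n.+1 K) :=
  \bigcap_(P in [set P | P \in Z]) ideal_exp (vanishing_ideal [fset P]%fset) k.

Definition pspan (S : {fset proj_point}) : {vspace 'rV[K]_n.+1} :=
  (\sum_(P <- S) val P)%VS.

(* An r-dimensional projective subspace has vector space dimension r + 1. *)
Definition linearly_general_position (Z : {fset proj_point}) : Prop :=
  forall (r : nat) (S : {fset proj_point}), (S `<=` Z)%fset ->
    #|` S| = r.+1 -> (r.+1 <= n.+1)%N -> \dim (pspan S) = r.+1.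

Definition waldschmidt (R : realType) (Z : {fset proj_point}) : R :=
  limn (fun k : nat => (alpha (symbolic_power Z k))%:R / k%:R : R).

End ProjectiveSpace.

(* Main.v *)
(* Since |Z| <= n + 3 is less than the dimension (n+2)(n+1)/2 of the space of
   quadrics, alpha(I_Z) <= 2, so the claimed bound is at most (n+1)/n. That value
   is already forced by n + 1 spanning points of Z: move them to the coordinate
   points by a linear substitution; a form of degree d in the k-th symbolic power
   then only has monomials m with m_i + k <= d for every i, and summing over i
   gives (n+1) k <= n d. The limit exists by Fekete's lemma, alpha of the
   symbolic powers being subadditive. *)
From HB Require Import structures.
Require Import Defs.
From mathcomp Require Import all_boot all_order all_algebra finmap.
From mathcomp Require Import reals.
From mathcomp Require Import boolp classical_sets topology normedtype sequences.
From mathcomp Require Import -(notations) mpoly.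
From mathcomp Require Import zify lra.

Import Order.TTheory GRing.Theory Num.Theory.
Import numFieldNormedType.Exports.

Local Open Scope ring_scope.

(** * Generated ideals and their powers *)

Section IdealPowers.
Context {A : comNzRingType}.
Implicit Types (S I : set A) (f g : A).

Lemma ideal_gen_incl S f : S f -> ideal_gen S f.
Proof.
move=> Sf; exists [:: (1, f)]; last by rewrite big_seq1 mul1r.
by move=> x; rewrite inE => /eqP ->.
Qed.

(** Minimality of the generated ideal, phrased as an induction principle for membership. *)
Lemma ideal_gen_ind S (J : A -> Prop) :
  J 0 -> (forall f g, J f -> J g -> J (f + g)) ->
  (forall f g, J g -> J (f * g)) -> (forall f, S f -> J f) ->
  forall f, ideal_gen S f -> J f.
Proof.
move=> J0 JD JM SJ f [s sS ->]; elim: s sS => [|x s IHs] sS.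
  by rewrite big_nil.
rewrite big_cons; apply: JD; first by apply/JM/SJ/sS; rewrite mem_head.
by apply: IHs => y ys; apply: sS; rewrite inE ys orbT.
Qed.

Lemma ideal_gen0 S : ideal_gen S 0.
Proof. by exists [::] => //; rewrite big_nil. Qed.

Lemma ideal_genD S f g : ideal_gen S f -> ideal_gen S g -> ideal_gen S (f + g).
Proof.
move=> [s sS ->] [t tS ->]; exists (s ++ t); last by rewrite big_cat.
by move=> x; rewrite mem_cat => /orP[/sS|/tS].
Qed.

Lemma ideal_genM S f g : ideal_gen S g -> ideal_gen S (f * g).
Proof.
move=> [s sS ->]; exists [seq (f * x.1, x.2) | x <- s].
  by move=> y /mapP[x xs ->]; apply: (sS x xs).
by rewrite big_map mulr_sumr; apply: eq_bigr => x _; rewrite mulrA.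
Qed.

Lemma ideal_exp_mulr I k f g : ideal_exp I k g -> ideal_exp I k (f * g).
Proof. by case: k => // k; apply: ideal_genM. Qed.

Lemma ideal_exp0 I k : ideal_exp I k 0.
Proof. by case: k => // k; apply: ideal_gen0. Qed.

Lemma ideal_expD I k f g :
  ideal_exp I k f -> ideal_exp I k g -> ideal_exp I k (f + g).
Proof. by case: k => // k; apply: ideal_genD. Qed.

Lemma ideal_expM I a b f g :
  ideal_exp I a f -> ideal_exp I b g -> ideal_exp I (a + b) (f * g).
Proof.
move=> + Ig; elim: a f => [|a IHa] f; first by move=> _; apply: ideal_exp_mulr.
move: f; apply: ideal_gen_ind => [|f1 f2|f1 f2|_ [p [q [Ip Iq ->]]]].
- by rewrite mul0r; apply: ideal_exp0.
- by rewrite mulrDl; apply: ideal_expD.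
- by rewrite -mulrA; apply: ideal_exp_mulr.
- rewrite addSn -mulrA; apply: ideal_gen_incl.
  by exists p, (q * g); split=> //; apply: IHa.
Qed.

Lemma ideal_exp_exprn I k f : I f -> ideal_exp I k (f ^+ k).
Proof.
move=> If; elim: k => // k IHk; rewrite exprS; apply: ideal_gen_incl.
by exists f, (f ^+ k).
Qed.

(** A multiplicative filtration that contains [I] in level 1 contains its powers in the matching
    levels. As level 0 is the whole ring, multiplicativity also makes each level absorb products,
    hence an ideal. It is applied to the order of vanishing at a point. *)
Lemma ideal_exp_filtration I (J : nat -> A -> Prop) :
  (forall f, J 0%N f) -> (forall k, J k 0) ->
  (forall k f g, J k f -> J k g -> J k (f + g)) ->
  (forall a b f g, J a f -> J b g -> J (a + b)%N (f * g)) ->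
  (forall f, I f -> J 1%N f) ->
  forall k f, ideal_exp I k f -> J k f.
Proof.
move=> JT J0 JD JM IJ; elim=> // k IHk.
apply: ideal_gen_ind => //; first exact: JD.
  by move=> f g; apply: (JM 0%N).
by move=> _ [p [q [Ip Iq ->]]]; rewrite -add1n; apply: JM; [apply: IJ|apply: IHk].
Qed.

End IdealPowers.

(** * The initial degree [alpha] *)

Section InitialDegree.
Context {K : fieldType} {N : nat}.
Implicit Types (I : set (mpoly N K)) (f : mpoly N K).

Lemma alpha_le I j f :
  I f -> homogeneous j f -> f != 0 -> (alpha I <= j)%N.
Proof.
move=> If hf f0; rewrite /alpha; case: pselect => // exP.
by case: ex_minnP => m _; apply; apply/asboolP; exists f.
Qed.

(** One nonzero form in [I] rules out the junk value, so the minimum is attained. *)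
Lemma alpha_witness I j f :
  I f -> homogeneous j f -> f != 0 ->
  exists g, [/\ I g, homogeneous (alpha I) g & g != 0].
Proof.
move=> If hf f0; rewrite /alpha; case: pselect => [exP|[]].
  by case: ex_minnP => m /asboolP.
by exists j; apply/asboolP; exists f.
Qed.

End InitialDegree.

(** * Fekete's lemma for sequences of natural numbers *)

Section Fekete.
Context {R : realType} {a : nat -> nat}.
Hypothesis a_subadd : forall i j, (a (i + j) <= a i + a j)%N.

(** The term [a 0] covers [q = 0]: subadditivity does not force it to vanish. *)
Lemma subadditive_muln q m : (a (q * m) <= a 0 + q * a m)%N.
Proof.
elim: q => [|q IHq]; first by rewrite !mul0n addn0.
by rewrite mulSn (leq_trans (a_subadd _ _))// mulSn; lia.
Qed.

(** Euclidean division of [k] by [m]: the remainder is below [m], so its contribution is bounded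
    independently of [k]. *)
Lemma subadditive_edivn m k :
  (0 < m)%N -> (a k <= k %/ m * a m + (a 0 + a 0 + m * a 1))%N.
Proof.
move=> m0; rewrite {1}(divn_eq k m).
have := subadditive_muln (k %/ m) m; have := subadditive_muln (k %% m) 1.
have := a_subadd (k %/ m * m) (k %% m).
have : (k %% m * a 1 <= m * a 1)%N by rewrite leq_mul2r ltnW ?orbT// ltn_pmod.
rewrite muln1; lia.
Qed.

(** The limit is the infimum of the ratios: choose [m] whose ratio is within [e / 2] of it, then [k]
    so large that the bounded remainder term divided by [k] is at most [e / 2]. *)
Lemma cvgn_subadditive_ratio : cvgn (fun k => (a k)%:R / k%:R : R).
Proof.
pose u k := (a k)%:R / k%:R : R.
(* Index 0 is excluded: [u 0] is 0 by the convention on division by zero and would make the infimum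
   0. *)
pose E := [set u k | k in [set k | (0 < k)%N]]%classic.
have E_inf : has_inf E.
  split; first by exists (u 1%N), 1%N.
  by exists 0 => _ [k _ <-]; rewrite divr_ge0.
apply/cvg_ex; exists (inf E); apply/cvgrPdist_le => e e0.
have [|_ [m /= m0 <-] um] := @inf_adherent _ E (e / 2) _ E_inf.
  by rewrite divr_gt0.
pose C := (a 0 + a 0 + m * a 1)%N.
exists (maxn 1 (Num.truncn (C%:R / (e / 2))).+1) => // k /=.
rewrite geq_max => /andP[k0 Ck].
have kR0 : 0 < k%:R :> R by rewrite ltr0n.
have Ek : inf E <= u k by apply: ge_inf; [case: E_inf|exists k].
rewrite distrC ger0_norm ?subr_ge0//.
suff : u k <= u m + e / 2 by rewrite -/(u k); lra.
rewrite /u ler_pdivrMr// mulrDl.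
have H : (a k)%:R <= (k %/ m)%:R * (a m)%:R + C%:R :> R.
  by rewrite -natrM -natrD ler_nat subadditive_edivn.
apply: (le_trans H); apply: lerD.
  rewrite [leRHS]mulrAC ler_pdivlMr ?ltr0n// mulrC mulrA [leRHS]mulrC.
  by rewrite ler_wpM2r// -natrM ler_nat mulnC leq_divM.
rewrite mulrC -ler_pdivrMr ?divr_gt0//.
apply: ltW; apply: lt_le_trans (truncnS_gt _) _.
by rewrite ler_nat.
Qed.

End Fekete.

(** * Linear changes of coordinates and vanishing order at coordinate points *)

Section LinearSubstitution.
Context {K : fieldType} {N : nat}.
Implicit Types (A B : 'M[K]_N) (f g : mpoly N K) (i : 'I_N).

(** The coefficients of the [i]-th form are column [i] of [A], so substituting these forms amounts
    to evaluating at [w *m A] for a row vector [w]. *)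
Definition linear_forms A : N.-tuple (mpoly N K) :=
  [tuple \sum_j A j i *: mpolyX K (mnm1 j) | i < N].

Lemma meval_linear_forms A f (w : 'I_N -> K) :
  meval w (comp_mpoly (linear_forms A) f) =
  meval (fun i => \sum_j A j i * w j) f.
Proof.
rewrite comp_mpoly_meval; apply: meval_eq => i.
rewrite tnth_mktuple raddf_sum; apply: eq_bigr => j _ /=.
by rewrite mevalZ mevalXU.
Qed.

(** The two substitutions compose to that of [A *m B]. This is checked on monomials, since over a
    finite field values do not determine a polynomial. *)
Lemma linear_formsK A B : A *m B = 1%:M ->
  cancel (comp_mpoly (linear_forms B)) (comp_mpoly (linear_forms A)).
Proof.
move=> AB1 f; rewrite -[RHS]comp_mpoly_id [in RHS]comp_mpolyEX.
rewrite [X in comp_mpoly _ X = _]comp_mpolyEX raddf_sum; apply: eq_bigr => m _ /=.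
rewrite !comp_mpolyZ; congr (_ *: _).
rewrite !comp_mpolyX rmorph_prod; apply: eq_bigr => i _ /=.
rewrite rmorphXn /= !tnth_mktuple raddf_sum /=; congr (_ ^+ _).
under eq_bigr => j _.
  rewrite comp_mpolyZ comp_mpolyXU -tnth_nth tnth_mktuple scaler_sumr.
  under eq_bigr do rewrite scalerA mulrC.
  over.
rewrite exchange_big /=.
under eq_bigr => k _.
  rewrite -scaler_suml.
  have -> : \sum_j A k j * B j i = (k == i)%:R.
    by move/matrixP/(_ k i): AB1; rewrite !mxE.
  over.
rewrite (bigD1 i)//= eqxx scale1r big1 ?addr0// => k /negPf ->.
by rewrite scale0r.
Qed.

Lemma homogeneous_linear_forms A d f :
  homogeneous d f -> homogeneous d (comp_mpoly (linear_forms A) f).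
Proof.
move=> fd; rewrite /homogeneous comp_mpolyEX big_seq; apply: rpred_sum => m mf.
have <- : mdeg m = d by apply: (dhomogP _ _ _ fd).
apply: rpredZ; rewrite comp_mpolyX mdegE.
apply: (big_ind2 (fun p e => p \is ishomog1 e mdeg)).
- exact: dhomog1.
- by move=> p e q e' hp hq; apply: dhomogM.
move=> i _; rewrite -[X in ishomog1 X _]mul1n; apply: dhomogMn.
rewrite tnth_mktuple; apply: rpred_sum => j _.
by apply: rpredZ; rewrite dhomogX /= mdeg1.
Qed.

(* [orderge i k g]: [g] vanishes to order at least [k] at the [i]-th coordinate
   point, expressed on the monomials of [g]. *)
Definition orderge i (k : nat) g :=
  forall m, m \in msupp g -> (m i + k <= mdeg m)%N.

Lemma leq_mdeg (m : multinom N) i : (m i <= mdeg m)%N.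
Proof. by rewrite mdegE (bigD1 i)//= leq_addr. Qed.

Lemma mdeg_concentrated {m : multinom N} {i} :
  m i = mdeg m -> m = mnm_muln (mnm1 i) (mdeg m).
Proof.
move=> mi; apply/mnmP => j; rewrite mulmnE mnm1E.
have [<-|ij] := eqVneq i j; first by rewrite mul1n.
have := mi; rewrite mdegE (bigD1 i)//= (bigD1 j) 1?eq_sym//=.
by rewrite mul0n; lia.
Qed.

Lemma orderge0 i g : orderge i 0 g.
Proof. by move=> m _; rewrite addn0 leq_mdeg. Qed.

Lemma ordergeD i k f g : orderge i k f -> orderge i k g -> orderge i k (f + g).
Proof.
by move=> kf kg m /msuppD_le; rewrite mem_cat => /orP[/kf|/kg].
Qed.

Lemma ordergeM i a b f g :
  orderge i a f -> orderge i b g -> orderge i (a + b) (f * g).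
Proof.
move=> af bg m /msuppM_le /allpairsP[[p q] /= [/af pa /bg qb ->]].
by rewrite mnmDE mdegD; lia.
Qed.

(** At the [i]-th coordinate point every monomial of degree [d] vanishes except the pure power of
    the [i]-th variable, so the value of [g] there is the coefficient of that power. *)
Lemma orderge1_homogeneous i d g : homogeneous d g ->
  meval (fun j => (j == i)%:R) g = 0 -> orderge i 1 g.
Proof.
move=> gd gi m mg; rewrite addn1 ltn_neqAle leq_mdeg andbT.
have deg m' : m' \in msupp g -> mdeg m' = d by apply: (dhomogP _ _ _ gd).
apply/eqP => mi; move: mg (mg); rewrite {1}mcoeff_msupp => /eqP + mg; apply.
rewrite -[RHS]gi mevalE (bigD1_seq m)//= ?msupp_uniq//.
rewrite [X in _ + X]big1_seq ?addr0 => [|m' /andP[m'm m'g]].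
  rewrite big1 ?mulr1// => j _; rewrite (mdeg_concentrated mi) mulmnE mnm1E eq_sym.
  by case: eqP; rewrite ?expr1n// mul0n expr0.
(* A monomial of the same degree other than [m] involves some variable [j != i], which is 0 at the
   point. *)
have [j /andP[ji m'j]] : exists j, (j != i) && (m' j != 0%N).
  apply/existsP; apply: contraNT m'm; rewrite negb_exists => /forallP m'0.
  have m'i : m' i = mdeg m'.
    rewrite mdegE (bigD1 i)//= big1 ?addn0// => j ji.
    by have := m'0 j; rewrite ji negbK => /eqP.
  by rewrite (mdeg_concentrated mi) (mdeg_concentrated m'i) !deg.
by rewrite (bigD1 j)//= (negPf ji) expr0n (negPf m'j) mul0r mulr0.
Qed.

End LinearSubstitution.

(** * Forms through points and symbolic powers *)

Section Points.
Context {K : fieldType} {n : nat}.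
Implicit Types (P : proj_point K n) (Z : {fset proj_point K n}).

Definition point_rep P : 'rV[K]_n.+1 := vpick (val P).

Lemma point_rep_neq0 P : point_rep P != 0.
Proof. by rewrite vpick0 -dimv_eq0 (eqP (valP P)). Qed.

Lemma point_line P : val P = <[point_rep P]>%VS.
Proof.
apply/esym/eqP; rewrite eqEdim -memvE memv_pick (eqP (valP P)) dim_vline.
by rewrite point_rep_neq0.
Qed.

Lemma meval_homogeneousZ d (f : mpoly n.+1 K) (c : K) (w : 'I_n.+1 -> K) :
  homogeneous d f -> meval (fun i => c * w i) f = c ^+ d * meval w f.
Proof.
move=> fd; rewrite !mevalE mulr_sumr !big_seq; apply: eq_bigr => m mf.
rewrite mulrCA; congr (_ * _).
have <- : mdeg m = d by apply: (dhomogP _ _ _ fd).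
under eq_bigr do rewrite exprMn.
by rewrite big_split /= mdegE expr_sum.
Qed.

(** Rescaling the representative by [c] multiplies the value by [c ^+ d], so one representative
    decides. *)
Lemma vanishes_at_rep d f P : homogeneous d f ->
  meval (point_rep P ord0) f = 0 -> vanishes_at f P.
Proof.
move=> fd f0 v; rewrite point_line => /vlineP[c ->] _.
rewrite (@meval_eq _ _ _ (fun i => c * point_rep P ord0 i)) => [|i].
  by rewrite (meval_homogeneousZ _ _ _ _ fd) f0 mulr0.
by rewrite mxE.
Qed.

(** Evaluation at the points of [Z] is linear on the forms of degree [d], a space of dimension
    ['C(d + n, d)]; with fewer points than that, its kernel is nonzero. *)
Lemma hypersurface_through d Z : (#|` Z| < 'C(d + n, d))%N ->
  exists f, [/\ homogeneous d f, f != 0 & forall P, P \in Z -> vanishes_at f P].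
Proof.
move=> Zd; pose z i := tnth (in_tuple (enum_fset Z)) i.
pose ev (p : dhomog n.+1 K d) : 'rV[K]_(size (enum_fset Z)) :=
  \row_i meval (point_rep (z i) ord0) (mpoly_of_dhomog p).
have ev_lin : linear ev.
  by move=> c p q; apply/rowP => i; rewrite !mxE linearP.
pose evL := GRing.isLinear.Build _ _ _ _ ev ev_lin.
pose eva : {linear dhomog n.+1 K d -> 'rV[K]_(size (enum_fset Z))} :=
  HB.pack ev evL.
have kerN0 : lker (linfun eva) != 0%VS.
  apply: contraTneq Zd => ker0; rewrite -leqNgt.
  have := limg_ker_dim (linfun eva) fullv.
  rewrite ker0 capv0 dimv0 add0n dimvf => dimE.
  have := dimvS (subvf (linfun eva @: fullv)%VS).
  by rewrite dimE !dimvf /dim /= mul1n.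
exists (mpoly_of_dhomog (vpick (lker (linfun eva)))); split.
- exact: dhomog_is_dhomog.
- by rewrite -vpick0 in kerN0; apply: contra kerN0 => /eqP f0; apply/eqP/val_inj.
move=> P PZ; apply: (vanishes_at_rep d); first exact: dhomog_is_dhomog.
have := memv_pick (lker (linfun eva)); rewrite memv_ker lfunE /= => /eqP/rowP.
have /tnthP[i ->] : P \in in_tuple (enum_fset Z) by [].
by move=> /(_ i); rewrite !mxE.
Qed.

(** Representatives of a spanning set form the rows of a matrix of rank [n.+1], from which [n.+1]
    independent rows can be selected. *)
Lemma spanning_frame Z : pspan Z = fullv ->
  exists z : 'I_n.+1 -> proj_point K n, (forall i, z i \in Z) /\
    (\matrix_i point_rep (z i) : 'M[K]_n.+1) \in unitmx.
Proof.
move=> spanZ; pose t := in_tuple (enum_fset Z).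
pose M : 'M[K]_(size (enum_fset Z), n.+1) := \matrix_i point_rep (tnth t i).
have fullM : row_full M.
  rewrite -sub1mx; apply/row_subP => j.
  have : row j 1%:M \in pspan Z by rewrite spanZ memvf.
  rewrite /pspan big_tnth => /memv_sumP[vs vsP ->].
  apply: summx_sub => i _; have := vsP i isT.
  rewrite point_line => /vlineP[c ->]; apply: scalemx_sub.
  by apply: (eq_row_sub i); rewrite rowK.
exists (fun i => tnth t (fullrankfun fullM i)); split=> [i|].
  exact: (mem_tnth _ t).
have -> : \matrix_i point_rep (tnth t (fullrankfun fullM i)) =
  rowsub (fullrankfun fullM) M by apply/matrixP => i j; rewrite !mxE.
exact: fullrowsub_unit.
Qed.

Lemma symbolic_powerM Z a b f g :
  symbolic_power Z a f -> symbolic_power Z b g ->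
  symbolic_power Z (a + b) (f * g).
Proof. by move=> fa gb P PZ; apply: ideal_expM; [apply: fa|apply: gb]. Qed.

Lemma symbolic_power_exprn Z d k f : homogeneous d f ->
  (forall P, P \in Z -> vanishes_at f P) -> symbolic_power Z k (f ^+ k).
Proof.
move=> fd f0 P PZ; apply/ideal_exp_exprn/ideal_gen_incl.
by split=> [|Q /fset1P ->]; [exists d|apply: f0].
Qed.

(* Substituting the linear forms of [A] moves the [i]-th coordinate point to the
   point represented by row [i] of [A]. *)
Lemma orderge_ideal_exp (A : 'M[K]_n.+1) i P k f : row i A = point_rep P ->
  ideal_exp (vanishing_ideal [fset P]%fset) k f ->
  orderge i k (comp_mpoly (linear_forms A) f).
Proof.
move=> AP; move: k f.
(* Vanishing orders after substitution form a multiplicative filtration, so only the generators of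
   the ideal of [P] remain to be checked. *)
apply: (ideal_exp_filtration _
  (fun k f => orderge i k (comp_mpoly (linear_forms A) f))).
- by move=> f; apply: orderge0.
- by move=> k; rewrite comp_mpoly0 => m; rewrite msupp0.
- by move=> k f g; rewrite comp_mpolyD; apply: ordergeD.
- by move=> a b f g; rewrite rmorphM; apply: ordergeM.
apply: ideal_gen_ind.
- by rewrite comp_mpoly0 => m; rewrite msupp0.
- by move=> f g; rewrite comp_mpolyD; apply: ordergeD.
- by move=> f g g1; rewrite rmorphM; apply: (ordergeM _ 0%N) => //; apply: orderge0.
move=> f [[d fd] /(_ P (fset11 P)) fP].
apply: (orderge1_homogeneous _ _ _ (homogeneous_linear_forms A _ _ fd)).
rewrite meval_linear_forms -[RHS](fP (point_rep P)) ?memv_pick ?point_rep_neq0//.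
apply: meval_eq => j; rewrite -AP mxE (bigD1 i)//= eqxx mulr1 big1 ?addr0//.
by move=> l /negPf ->; rewrite mulr0.
Qed.

Lemma symbolic_power_degree Z k d f : pspan Z = fullv ->
  symbolic_power Z k f -> homogeneous d f -> f != 0 -> (n.+1 * k <= n * d)%N.
Proof.
move=> /spanning_frame[z [zZ]]; set A := \matrix_i _ => uA fk fd f0.
pose g := comp_mpoly (linear_forms A) f.
(* Substituting the inverse matrix recovers [f] from [g]. *)
have g0 : g != 0.
  apply: contra f0 => /eqP g0.
  by rewrite -[f](linear_formsK _ _ (mulVmx uA)) -/g g0 comp_mpoly0.
have gk i : orderge i k g.
  by apply: (orderge_ideal_exp _ _ (z i)); [rewrite rowK|apply: fk; apply: zZ].
have gd := homogeneous_linear_forms A _ _ fd.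
have mg := mlead_supp g0.
have md : mdeg (mlead g) = d by apply: (dhomogP _ _ _ gd).
(* A single monomial of [g] suffices. Its exponents sum to [d], so this reads
   [d + n.+1 * k <= n.+1 * d]. *)
have : (\sum_(i < n.+1) (mlead g i + k) <= \sum_(i < n.+1) d)%N.
  by apply: leq_sum => i _; rewrite -md gk.
by rewrite big_split /= -mdegE md !sum_nat_const card_ord mulSn leq_add2l.
Qed.

End Points.

Theorem corollary5p5 (R : realType) (K : fieldType) (n : nat)
    (Z : {fset proj_point K n}) (hn : (2 <= n)%N)
    (hcard : (#|` Z| <= n + 3)%N)
    (hspan : pspan Z = fullv)
    (hgen : #|` Z| = (n + 3)%N -> linearly_general_position Z) :
  ((alpha (vanishing_ideal Z))%:R + n%:R - 1) / n%:R <= waldschmidt R Z.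
Proof.
have [|q [q2 q0 qZ]] := @hypersurface_through K n 2 Z.
  (* What is left is [n + 4 <= (n + 2) * (n + 1) / 2], compared after doubling; equality holds at
     [n = 2]. *)
  apply: leq_ltn_trans hcard _; rewrite bin2 -[X in (X <= _)%N]doubleK.
  by apply: half_leq; rewrite add2n /= -mul2n; nia.
(* The powers of the quadric [q] show that every symbolic power contains a nonzero form, so [alpha]
   never takes its junk value here. *)
have wit k : exists f, [/\ symbolic_power Z k f,
    homogeneous (alpha (symbolic_power Z k)) f & f != 0].
  apply: (alpha_witness _ (2 * k) (q ^+ k)).
  - exact: (symbolic_power_exprn _ _ _ _ q2 qZ).
  - exact: dhomogMn.
  - exact: expf_neq0.
have alphaZ : (alpha (vanishing_ideal Z) <= 2)%N.
  by apply: (alpha_le _ _ _ _ q2 q0); apply: ideal_gen_incl; split=> //; exists 2%N.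
have n0 : 0 < n%:R :> R by rewrite ltr0n; lia.
apply: (@le_trans _ _ (n.+1%:R / n%:R)).
  rewrite ler_pM2r ?invr_gt0// -natr1.
  by move: alphaZ; rewrite -(ler_nat R); lra.
apply: limr_ge.
  (* Subadditivity: the product of two forms of minimal degree is a nonzero form in the symbolic
     power of index [i + j]. *)
  apply: cvgn_subadditive_ratio => i j.
  have [f [fi fd f0]] := wit i; have [g [gj gd g0]] := wit j.
  apply: (alpha_le _ _ _ (symbolic_powerM _ _ _ _ _ fi gj) _ (mulf_neq0 f0 g0)).
  exact: dhomogM.
(* The bound starts at [k = 1], since the ratio at [k = 0] is 0 by convention. *)
exists 1%N => // k /= k0; have [f [fk fd f0]] := wit k.
rewrite ler_pdivlMr ?ltr0n// mulrAC ler_pdivrMr// -!natrM ler_nat [leqRHS]mulnC.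
by apply: (symbolic_power_degree _ _ _ _ hspan fk fd f0).
Qed.
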